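(* Let $X_1,X_2$ be bounded metric spaces. Then the metric segment $[X_1,X_2]$ cannot be infinitely extended beyond both its endpoints; that is, it is not true that for every real $L>0$ there exist metric spaces $Y_1,Y_2$ such that $d_{GH}(Y_1,Y_2)<\infty$, $d_{GH}(X_1,Y_1)>L$, $d_{GH}(X_2,Y_2)>L$ and $$d_{GH}(Y_1,Y_2)=d_{GH}(Y_1,X_1)+d_{GH}(X_1,X_2)+d_{GH}(X_2,Y_2).$$
   Context: All metric spaces are non-empty, with finite distances. $d_{GH}$ is the Gromov--Hausdorff distance, $d_{GH}(X,Y)=\frac12\inf\operatorname{dis}R$ over all correspondences $R\subset X\times Y$ (subsets projecting surjectively onto both factors), where $\operatorname{dis}R=\sup\{\bigl||xx'|-|yy'|\bigr|:(x,y),(x',y')\in R\}$. The metric segment $[X,Y]$ (defined when $d_{GH}(X,Y)<\infty$) is the class of all metric spaces $W$ with $d_{GH}(X,W)+d_{GH}(W,Y)=d_{GH}(X,Y)$. *)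

(* Defs.v *)
From mathcomp Require Import all_boot all_order all_algebra.
From mathcomp Require Import all_classical all_reals all_analysis.

Set Implicit Arguments.
Unset Strict Implicit.
Unset Printing Implicit Defensive.

Import Order.TTheory GRing.Theory Num.Theory.

Local Open Scope classical_set_scope.
Local Open Scope ring_scope.

(* A [metricType R] may be empty: non-emptiness is a separate hypothesis,
   written [[set: X] !=set0]. *)

Definition bounded_space {R : realType} (X : metricType R) : Prop :=
  exists M : R, forall x x' : X, mdist x x' <= M.

Definition correspondence {X Y : Type} (C : set (X * Y)) : Prop :=
  fst @` C = [set: X] /\ snd @` C = [set: Y].

Definition distortion {R : realType} {X Y : metricType R} (C : set (X * Y))
    : \bar R :=
  ereal_sup [set `|mdist p.1 q.1 - mdist p.2 q.2|%:E | p in C & q in C].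

Definition dGH {R : realType} (X Y : metricType R) : \bar R :=
  (2^-1%:E * ereal_inf [set distortion C | C in @correspondence X Y])%E.

(* Main.v *)
(** A correspondence between a space [Y] and a space [X] of diameter at most
    [M] distorts distances by at least [diam Y - M], so
    [diam Y <= M + 2 d_GH(X, Y)]; conversely the full correspondence shows that
    [2 d_GH(Y1, Y2) <= max (diam Y1) (diam Y2)].  With [a = d_GH(Y1, X1)] and
    [b = d_GH(X2, Y2)] both finite, this yields
    [a + b <= d_GH(Y1, Y2) <= M / 2 + max a b], i.e. [min a b <= M / 2]:
    the segment cannot be extended by more than [M / 2] beyond both ends. *)
Require Import Defs.
From mathcomp Require Import all_boot all_order all_algebra.
From mathcomp Require Import all_classical all_reals all_analysis.
From mathcomp Require Import lra.
Import Order.TTheory GRing.Theory Num.Theory.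

Local Open Scope classical_set_scope.
Local Open Scope ring_scope.

Section GromovHausdorff.
Context {R : realType}.
Implicit Types X Y : metricType R.

Definition converse_rel {A B : Type} (C : set (A * B)) : set (B * A) :=
  [set p | C (p.2, p.1)].

Lemma correspondence_converse {A B : Type} (C : set (A * B)) :
  correspondence C -> correspondence (converse_rel C).
Proof.
move=> [CA CB]; split; apply/seteqP; split => // z _.
- by have : [set: B] z by []; rewrite -CB => -[[x y] Cxy <-]; exists (y, x).
- by have : [set: A] z by []; rewrite -CA => -[[x y] Cxy <-]; exists (y, x).
Qed.

Lemma distortion_converse_le X Y (C : set (X * Y)) :
  (distortion (converse_rel C) <= distortion C)%E.
Proof.
apply: ereal_sup_le => _ [p Cp] [q Cq] <-.
by exists (p.2, p.1) => //; exists (q.2, q.1) => //=; rewrite distrC.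
Qed.

(** Reversing a correspondence does not increase its distortion; exchanging the spaces then turns
    this one inequality into symmetry. *)
Lemma dGH_le_sym X Y : (dGH X Y <= dGH Y X)%E.
Proof.
apply: lee_wpmul2l; first by rewrite lee_fin invr_ge0.
apply: le_ereal_inf_tmp => _ [C corrC <-].
apply: (le_trans _ (distortion_converse_le _ _ C)).
apply: ereal_inf_lbound; exists (converse_rel C) => //.
exact: correspondence_converse.
Qed.

Lemma dGHC X Y : dGH X Y = dGH Y X.
Proof. by apply/le_anti; rewrite !dGH_le_sym. Qed.

Lemma distortion_ge0 X Y (C : set (X * Y)) : C !=set0 -> (0 <= distortion C)%E.
Proof.
move=> [p Cp]; apply: le_ereal_sup_tmp.
by exists (`|mdist p.1 p.1 - mdist p.2 p.2|%:E); [exists p => //; exists p | rewrite lee_fin].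
Qed.

(** A point of [X] makes every correspondence non-empty, so that no distortion is the supremum [-oo]
    of the empty set. *)
Lemma dGH_ge0 X Y : [set: X] !=set0 -> (0 <= dGH X Y)%E.
Proof.
move=> [x _]; apply: mule_ge0; first by rewrite lee_fin invr_ge0.
apply: le_ereal_inf_tmp => _ [C [C1 _] <-].
apply: distortion_ge0.
by have : [set: X] x by []; rewrite -C1 => -[p Cp _]; exists p.
Qed.

Lemma dGH_le_diam X Y (D : R) : [set: X] !=set0 -> [set: Y] !=set0 ->
  (forall x x' : X, mdist x x' <= D) -> (forall y y' : Y, mdist y y' <= D) ->
  (dGH X Y <= (2^-1 * D)%:E)%E.
Proof.
move=> [x0 _] [y0 _] DX DY; rewrite EFinM; apply: lee_wpmul2l; first by rewrite lee_fin invr_ge0.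
apply: (@le_trans _ _ (distortion [set: X * Y])).
  apply: ereal_inf_lbound; exists setT => //; split; apply/seteqP; split => // z _.
  - by exists (z, y0).
  - by exists (x0, z).
apply: ge_ereal_sup => _ [p _] [q _] <-; rewrite lee_fin.
have := DX p.1 q.1; have := DY p.2 q.2.
have := mdist_ge0 p.1 q.1; have := mdist_ge0 p.2 q.2.
by rewrite ler_norml; lra.
Qed.

(** Any partners of [x] and [x'] are at most [M] apart. The bound is pointwise because [X] may be
    unbounded. *)
Lemma dGH_ge_mdist X Y (M : R) (x x' : X) : (forall y y' : Y, mdist y y' <= M) ->
  ((2^-1 * (mdist x x' - M))%:E <= dGH X Y)%E.
Proof.
move=> MY; rewrite EFinM; apply: lee_wpmul2l; first by rewrite lee_fin invr_ge0.
apply: le_ereal_inf_tmp => _ [C [C1 _] <-].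
have : [set: X] x' by []; have : [set: X] x by [].
rewrite -C1 => -[p Cp <-] [q Cq <-].
apply: (@le_trans _ _ (`|mdist p.1 q.1 - mdist p.2 q.2|%:E)).
  rewrite lee_fin (le_trans _ (ler_norm _))//.
  by have := MY p.2 q.2; lra.
by apply: ereal_sup_ubound; exists p => //; exists q.
Qed.

End GromovHausdorff.

Theorem corollary4p19 (R : realType) (X1 X2 : metricType R)
    (hX1 : [set: X1] !=set0) (hX2 : [set: X2] !=set0)
    (bX1 : bounded_space X1) (bX2 : bounded_space X2) :
  ~ (forall L : R, 0 < L ->
      exists Y1 Y2 : metricType R,
        [set: Y1] !=set0 /\ [set: Y2] !=set0 /\
        (dGH Y1 Y2 < +oo)%E /\
        (L%:E < dGH X1 Y1)%E /\
        (L%:E < dGH X2 Y2)%E /\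
        dGH Y1 Y2 = (dGH Y1 X1 + dGH X1 X2 + dGH X2 Y2)%E).
Proof.
move: bX1 bX2 => [M1 bX1] [M2 bX2] ext.
(* The 1 only ensures [M > 0], so that [M] itself can serve as [L]. *)
pose M := Num.max 1 (Num.max M1 M2).
have M_gt0 : 0 < M by rewrite lt_max ltr01.
have [Y1 [Y2 [Y1n0 [Y2n0 [fin [L1 [L2 dE]]]]]]] := ext _ M_gt0.
have MX1 x x' : @mdist R X1 x x' <= M by rewrite !le_max bX1 !orbT.
have MX2 x x' : @mdist R X2 x x' <= M by rewrite !le_max bX2 !orbT.
have lb1 y y' := dGH_ge_mdist Y1 X1 M y y' MX1.
have lb2 y y' := dGH_ge_mdist Y2 X2 M y y' MX2.
have up D := dGH_le_diam Y1 Y2 D Y1n0 Y2n0.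
move: up lb1 lb2 fin L1 L2; rewrite dE (dGHC Y2) (dGHC X1 Y1).
move: (dGH_ge0 X1 X2 hX1).
(* All three distances are real: [-oo] violates a lower bound, and [+oo] would make the sum
   infinite. *)
case: (dGH Y1 X1) => [a| |] //; case: (dGH X2 Y2) => [b| |] //;
  case: (dGH X1 X2) => [c| |] //.
rewrite !lee_fin !lte_fin => c0 up lb1 lb2 _ La Lb.
(* By [lb1] and [lb2] this bounds both diameters. *)
have := up (M + 2 * Num.max a b).
have le_a : a <= Num.max a b by rewrite le_max lexx.
have le_b : b <= Num.max a b by rewrite le_max lexx orbT.
have H1 y y' : @mdist R Y1 y y' <= M + 2 * Num.max a b.
  by have := lb1 y y'; rewrite lee_fin; lra.
have H2 y y' : @mdist R Y2 y y' <= M + 2 * Num.max a b.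
  by have := lb2 y y'; rewrite lee_fin; lra.
move=> /(_ H1 H2); rewrite -!EFinD lee_fin.
(* Now [a + c + b <= M / 2 + max a b] with [c >= 0], so [min a b <= M / 2 < M], against [M < a] and
   [M < b]. *)
by case: (leP a b) => _; lra.
Qed.
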